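(* $$\limsup_{p\to\infty} \frac{|\Lambda_p|}{p^2}=\frac12,$$ where the limit superior is over primes $p$.
   Context: For a prime $p$, $\Lambda_p$ is the set of pairs $(P,Q)\in\{1,\ldots,p-1\}^2$ such that the sequence $[P,Q]$ ($F_0=0$, $F_1=1$, $F_{n+1}=PF_n-QF_{n-1}$ for $n\ge1$) is complete modulo $p$, i.e. for every integer $k$ there exists $n\ge0$ with $F_n\equiv k\pmod p$. *)

(* Defs.v *)
From HB Require Import structures.
From mathcomp Require Import all_boot all_order all_algebra.
From mathcomp Require Import all_classical all_reals all_analysis.
Set Implicit Arguments.
Unset Strict Implicit.
Unset Printing Implicit Defensive.
Import Order.TTheory GRing.Theory Num.Theory.
Local Open Scope ring_scope.

Fixpoint lucas (P Q : int) (n : nat) : int :=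
  match n with
  | 0%N => 0
  | 1%N => 1
  | (m.+1 as m1).+1 => P * lucas P Q m1 - Q * lucas P Q m
  end.

Definition complete_mod (p : nat) (P Q : int) : Prop :=
  forall k : int, exists n : nat, (lucas P Q n = k %[mod p%:Z])%Z.

(* Pairs in {1, ..., p-1}^2 are encoded as pairs in {0, ..., p-1}^2 with
   positive components. *)
Definition Lambda (p : nat) : {set 'I_p * 'I_p} :=
  [set PQ : 'I_p * 'I_p | [&& (0 < PQ.1)%N, (0 < PQ.2)%N &
    `[< complete_mod p (PQ.1 : nat)%:Z (PQ.2 : nat)%:Z >]]]%SET.

(* Main.v *)
(* Let x, y be the roots of X^2 - P X + Q over F_p, so that
   F_n = (x^n - y^n) / (x - y).  If x <> y both lie in F_p then the sequence
   has period p - 1 and misses a residue; this removes about p^2 / 2 pairs.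
   Otherwise x lies in the field F with p^2 elements, y = x^p, and k is
   attained iff L h = L (k x) for some power h of x, where L z = z^p - z.
   A second moment over the dilates c |-> #{h in <x> : L (c h) = L (k x)}, c
   in F, shows that this is always solvable when the order of x exceeds
   p^(3/2).  The divisor bound d(n) = O(n^(1/5)) leaves O(p^(19/10)) elements of
   smaller order, so almost all irreducible pairs are complete, and the ratio
   converges to 1/2 along all primes. *)
Require Import Defs.
From HB Require Import structures.
From mathcomp Require Import all_boot all_order all_algebra all_field all_fingroup.
From mathcomp Require Import all_classical all_reals all_analysis.
From mathcomp Require Import cyclic zify ring lra.
Set Implicit Arguments.
Unset Strict Implicit.
Unset Printing Implicit Defensive.
Import Order.TTheory GRing.Theory Num.Theory.
Local Open Scope ring_scope.

(** * The divisor bound d(n)^5 = O(n) *)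

(** The map taking [d] to (gcd(d, a), d / gcd(d, a)) is injective, and Gauss's lemma makes its
    second component a divisor of [b]. *)
Lemma size_divisorsM (a b : nat) : (0 < a)%N -> (0 < b)%N ->
  (size (divisors (a * b)) <= size (divisors a) * size (divisors b))%N.
Proof.
move=> a0 b0; have ab0 : (0 < a * b)%N by rewrite muln_gt0 a0.
pose f d := (gcdn d a, (d %/ gcdn d a)%N).
rewrite -(size_map f) -(size_allpairs pair) uniq_leq_size //.
  rewrite map_inj_in_uniq ?divisors_uniq // => d d' _ _ [eg eq].
  by rewrite -(divnK (dvdn_gcdl d a)) eq eg divnK ?dvdn_gcdl.
move=> _ /mapP[d + ->]; rewrite -dvdn_divisors // => dab.
have g0 : (0 < gcdn d a)%N by rewrite gcdn_gt0 a0 orbT.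
apply/allpairsP; exists (f d); split => //=; rewrite -dvdn_divisors ?dvdn_gcdr //.
have co : coprime (d %/ gcdn d a) (a %/ gcdn d a).
  by rewrite /coprime -(eqn_pmul2r g0) muln_gcdl !divnK ?dvdn_gcdl ?dvdn_gcdr ?mul1n.
by rewrite -(Gauss_dvdr b co) -(dvdn_pmul2r g0) mulnAC !divnK ?dvdn_gcdl ?dvdn_gcdr.
Qed.

Lemma size_divisors_pfactor (q a : nat) : prime q ->
  (size (divisors (q ^ a)) <= a.+1)%N.
Proof.
move=> pq; have -> : a.+1 = size (map (expn q) (iota 0 a.+1)) by rewrite size_map size_iota.
apply: uniq_leq_size (divisors_uniq _) _ => d.
rewrite -dvdn_divisors ?expn_gt0 ?prime_gt0 // => /dvdn_pfactor-/(_ pq)[m ma ->].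
by apply: map_f; rewrite mem_iota.
Qed.

(* (a+1)^5 <= 5! C(a+5, 5) <= 120 * 2^(a+5). *)
Lemma pow5_le (a : nat) : (a.+1 ^ 5 <= 3840 * 2 ^ a)%N.
Proof.
have le5 : (a.+1 ^ 5 <= (a + 5) ^_ 5)%N.
  rewrite addnC; do 5! rewrite ffactnS; rewrite ffactn0 muln1 !expnS expn0 muln1 /=.
  by rewrite !leq_mul //; lia.
have lebin : ('C(a + 5, 5) <= 2 ^ (a + 5))%N.
  rewrite -[2%N in leqRHS]/(1 + 1)%N Pascal (bigD1 (inord 5)) //= inordK ?leq_addr //; last by lia.
  by rewrite !exp1n !muln1 leq_addr.
apply: leq_trans le5 _; rewrite -bin_ffact.
apply: leq_trans (leq_mul lebin (leqnn _)) _.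
by rewrite expnD -mulnA mulnC.
Qed.

(** For [q] at least 32, (a+1)^5 <= 32^a <= q^a; a smaller [q] pays the constant of [pow5_le]. The
    exponent [q < 32] is a boolean read as 0 or 1. *)
Lemma size_divisors_pfactor_pow5 (q a : nat) : prime q ->
  (size (divisors (q ^ a)) ^ 5 <= 3840 ^ (q < 32) * q ^ a)%N.
Proof.
move=> pq; have := size_divisors_pfactor a pq.
rewrite -(leq_exp2r _ _ (isT : 0 < 5)%N) => /leq_trans; apply.
case: ltnP => [q32 | q32].
  by apply: leq_trans (pow5_le a) _; rewrite leq_mul2l; case: (a) => // a'; rewrite leq_exp2r ?prime_gt1.
rewrite expn0 mul1n (@leq_trans (32 ^ a)) //.
  by rewrite -[32%N]/(2 ^ 5)%N -expnM mulnC expnM leq_exp2r // ltn_expl.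
by case: (a) => // a'; rewrite leq_exp2r.
Qed.

Lemma size_divisors_pow5 :
  exists C, forall n : nat, (0 < n)%N -> (size (divisors n) ^ 5 <= C * n)%N.
(* Only primes q < 2^5 can contribute more than q^a to the fifth power. *)
Proof.
exists (3840 ^ 32)%N => n n0; pose A n := [set i : 'I_32 | prime i & (i %| n)%N].
(* The induction strips the full power of the least prime factor; the exponent counts small prime
   divisors, so that each of them costs 3840 only once. *)
suff le n' : (0 < n')%N -> (size (divisors n') ^ 5 <= 3840 ^ #|A n'| * n')%N.
  apply: leq_trans (le n n0) _; rewrite leq_mul2r leq_exp2l //.
  by rewrite (leq_trans (max_card _)) ?card_ord ?orbT.
elim/ltn_ind: n' => {n n0} n IHn n0.
have [n1|n1] := leqP n 1.
  have -> : n = 1%N by lia.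
  by rewrite muln1 exp1n expn_gt0.
set q := pdiv n; have pq : prime q by apply: pdiv_prime.
have qn : (q %| n)%N by apply: pdiv_dvd.
set m := (n`_q^')%N; have nE : n = (q ^ logn q n * m)%N by rewrite -p_part partnC.
have m0 : (0 < m)%N by apply: part_gt0.
have qm : coprime q m.
  by apply: (pnat_coprime (pnat_id pq)); exact: part_pnat.
have ln : (0 < logn q n)%N by rewrite logn_gt0 mem_primes pq n0.
have lt_mn : (m < n)%N.
  by rewrite [ltnRHS]nE ltn_Pmull // -(exp1n (logn q n)) ltn_exp2r // prime_gt1.
have cA : ((q < 32) + #|A m| <= #|A n|)%N.
  have sA : A m \subset A n.
    apply/fintype.subsetP => i; rewrite !inE => /andP[-> /= im].
    by rewrite nE dvdn_mull.
  case: ltnP => q32; last by rewrite subset_leq_card.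
  apply: proper_card; apply/properP; split=> //.
  exists (Ordinal q32); rewrite !inE pq //=.
  by rewrite -prime_coprime.
rewrite {1}nE.
apply: (@leq_trans ((size (divisors (q ^ logn q n)) * size (divisors m)) ^ 5)).
  by rewrite leq_exp2r // size_divisorsM // expn_gt0 prime_gt0.
rewrite expnMn; apply: leq_trans (leq_mul (size_divisors_pfactor_pow5 _ pq) (IHn _ lt_mn m0)) _.
rewrite mulnACA -expnD -nE leq_mul2r leq_exp2l // cA orbT //.
Qed.

(** * Two-to-one maps and the second moment over dilates *)

Lemma card_le_double_imset (T U : finType) (f : T -> U) (s : T -> T)
    (A : {set T}) :
  {in A &, forall x z, f z = f x -> z = x \/ z = s x} ->
  (#|A| <= 2 * #|f @: A|)%N.
Proof.
move=> fib; rewrite -sum1_card (partition_big_imset f) /= mulnC -sum_nat_const.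
apply: leq_sum => _ /imsetP[x xA ->]; rewrite sum1dep_card.
apply: leq_trans (_ : #|[set x; s x]| <= 2)%N; last by rewrite cards2; case: (_ == _).
apply: subset_leq_card; apply/fintype.subsetP => z; rewrite !inE => /andP[zA /eqP fz].
by case: (fib x z xA zA fz) => ->; rewrite eqxx ?orbT.
Qed.

(** The kernel of [L] is a field over which [L] is linear. Two solutions [c], [d] would put (d - c)
    h and (d - c) h' in it, hence also t = h' / h; then y = L (t c h) = t y forces h = h'. *)
Lemma card_dilates_le1 (F : finFieldType) (L : {additive F -> F})
    (h h' y : F) :
  (forall t x, L t = 0 -> L (t * x) = t * L x) -> L 1 = 0 ->
  h != 0 -> h != h' -> y != 0 ->
  (\sum_(c : F) (L (c * h)%R == y) * (L (c * h')%R == y) <= 1)%N.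
Proof.
move=> linL L1 h0 hh' y0.
under eq_bigr => c _ do rewrite mulnb; rewrite -big_mkcond /= sum1dep_card.
apply/card_le1P => c; rewrite inE => /andP[/eqP ch /eqP ch'] d; rewrite !inE.
apply/andP/eqP => [[/eqP dh /eqP dh'] | -> ]; last by rewrite ch ch' eqxx.
apply/eqP; rewrite -subr_eq0; apply/negPn/negP => dc0.
have k0 : L ((d - c) * h) = 0 by rewrite mulrBl raddfB /= dh ch subrr.
have k1 : L ((d - c) * h') = 0 by rewrite mulrBl raddfB /= dh' ch' subrr.
pose t := h' / h.
have tE : t * ((d - c) * h) = (d - c) * h' by rewrite /t; field.
have wn0 : (d - c) * h != 0 by rewrite mulf_neq0.
have kerV w : w != 0 -> L w = 0 -> L w^-1 = 0.
  move=> w0 lw; have := linL w w^-1 lw; rewrite divff // L1 => /esym/eqP.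
  by rewrite mulf_eq0 (negPf w0) => /eqP.
have Lt : L t = 0.
  have -> : t = ((d - c) * h') * ((d - c) * h)^-1 by rewrite -tE mulfK.
  by rewrite linL // kerV // mulr0.
have := linL t (c * h) Lt; rewrite (_ : t * (c * h) = c * h'); last by rewrite /t; field.
rewrite ch ch' -[X in X = _ -> _]mul1r => /(mulIf y0) t1.
by move: hh'; rewrite -[X in X == _]mul1r t1 /t mulfVK ?eqxx.
Qed.

Lemma card_dilates (F : finFieldType) (L : {additive F -> F}) (h u : F) :
  h != 0 ->
  (\sum_(c : F) (L (c * h)%R == L u))%N = #|[set t | L t == 0]|.
Proof.
move=> h0; rewrite -big_mkcond /= sum1dep_card.
rewrite -[RHS](@card_imset _ _ (fun t => (t + u) / h)); last first.
  by move=> t t' /(mulIf (invr_neq0 h0))/addIr.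
apply: eq_card => c; rewrite [LHS]inE; apply/eqP/imsetP => [Lc | [t + ->]].
  by exists (c * h - u); rewrite ?inE ?raddfB /= ?Lc ?subrr // subrK mulfK.
by rewrite inE mulfVK // => /eqP Lt; rewrite raddfD /= Lt add0r.
Qed.

(** Let N(c) count the [h] in [H] with L (c h) = L u; its mean over [F] is |H| / q. The moments [S1]
    and [S2] give sum (q N(c) - |H|)^2 <= q^3 |H|. Without a solution [N] vanishes on [H], whose
    terms alone amount to |H|^3, so |H|^2 <= q^3. *)
Lemma large_subgroup_onto (F : finFieldType) (L : {additive F -> F})
    (H : {group {unit F}}) (u : F) :
  let q := #|[set t | L t == 0]| in
  (forall t x, L t = 0 -> L (t * x) = t * L x) -> L 1 = 0 ->
  #|F| = (q ^ 2)%N -> (q ^ 3 < #|H| ^ 2)%N -> L u != 0 ->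
  exists2 h, h \in H & L (val h) = L u.
Proof.
move=> q linL L1 cF ltH u0.
have vn0 (h : {unit F}) : val h != 0 by rewrite -unitfE (valP h).
case: (pickP [pred h in H | L (val h) == L u]) => [h /andP[hH /eqP hu]|noH].
  by exists h.
exfalso; pose N c := (\sum_(h in H) (L (c * val h)%R == L u))%N.
have S1 : (\sum_c N c = #|H| * q)%N.
  rewrite exchange_big /= -sum_nat_const; apply: eq_bigr => h _.
  by rewrite card_dilates // vn0.
(* Pairs with h = h' contribute [q] each, all other pairs at most 1. *)
have S2 : (\sum_c N c ^ 2 <= #|H| * q + #|H| ^ 2)%N.
  under eq_bigr => c _ do rewrite -mulnn big_distrlr /=.
  rewrite exchange_big /= -mulnn -mulnDr -sum_nat_const; apply: leq_sum => h hH.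
  rewrite exchange_big /= (bigD1 h) //= leq_add //.
    under eq_bigr => c _ do rewrite mulnb andbb.
    by rewrite card_dilates ?vn0.
  rewrite -sum1_card [leqRHS](bigD1 h) //=; apply: leq_trans (leq_addl _ _).
  apply: leq_sum => h' /andP[_ hh']; apply: card_dilates_le1 => //.
  - exact: vn0.
  - by apply: contra hh' => /eqP e; apply/eqP/esym/val_inj.
(* For [c] in [H] the dilate of [H] by [c] is [H] itself, so a solution for [c] would give one for
   1. *)
have N0 c : c \in val @: H -> N c = 0%N.
  case/imsetP=> h hH ->; rewrite /N big1 // => h' h'H.
  have := noH (h * h')%g; rewrite inE groupM //= => ->//.
have cvH : #|val @: H| = #|H| by rewrite card_imset //; apply: val_inj.
pose D c : int := (q * N c)%:Z - #|H|%:Z.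
(* [N] vanishes on [H], where [D c ^+ 2 = #|H| ^ 2]. *)
have le : #|H|%:Z ^+ 3 <= \sum_c D c ^+ 2.
  rewrite (bigID (mem (val @: H))) /=.
  have -> : #|H|%:Z ^+ 3 = \sum_(c in val @: H) D c ^+ 2.
    rewrite (eq_bigr (fun=> #|H|%:Z ^+ 2)) => [|c /N0 Nc]; last first.
      by rewrite /D Nc muln0 sub0r sqrrN.
    by rewrite sumr_const cvH -mulr_natl natz -exprS.
  by rewrite lerDl sumr_ge0 // => c _; rewrite sqr_ge0.
have eqD : \sum_c D c ^+ 2 = q%:Z ^+ 2 * (\sum_c N c ^ 2)%N%:Z
    - 2%:Z * q%:Z * #|H|%:Z * (\sum_c N c)%N%:Z + q%:Z ^+ 2 * #|H|%:Z ^+ 2.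
  rewrite -!natz !natr_sum !mulr_sumr -sumrB.
  have -> : q%:R ^+ 2 * #|H|%:R ^+ 2 = \sum_(c : F) #|H|%:R ^+ 2 :> int.
    by rewrite sumr_const -[RHS]mulr_natl cF natrX.
  rewrite -big_split /=; apply: eq_bigr => c _; rewrite /D -!natz natrM natrX.
  ring.
move: le; rewrite eqD S1.
have {S2 eqD} : (\sum_c N c ^ 2)%N%:Z <= #|H|%:Z * q%:Z + #|H|%:Z ^+ 2 by lia.
have : q%:Z ^+ 3 < #|H|%:Z ^+ 2 by lia.
have : 0 < #|H|%:Z by rewrite ltz_nat cardG_gt0.
rewrite PoszM; move: (Posz _) (Posz #|H|) (Posz q) => s h r h0 lt le1 le2.
have : h ^+ 3 <= r ^+ 3 * h.
  have := ler_wpM2l (sqr_ge0 r) le1; nra.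
rewrite exprSr ler_pM2r //; lra.
Qed.

(** * Roots, Frobenius and Lucas sequences in characteristic p *)

Lemma card_root_XnD (F : finFieldType) (m : nat) (r : {poly F}) :
  (size r <= m)%N -> (#|[set x : F | (x ^+ m + r.[x] == 0)%R]| <= m)%N.
Proof.
move=> rm; have sP : size ('X^m + r) = m.+1 by rewrite size_polyDl size_polyXn.
rewrite cardE -ltnS -sP; apply: max_poly_roots; last exact: enum_uniq.
- by rewrite -size_poly_eq0 sP.
- by apply/allP => x; rewrite mem_enum inE rootE hornerD hornerXn.
Qed.

Lemma card_unity_roots (F : finFieldType) (m : nat) : (0 < m)%N ->
  (#|[set x : F | (x ^+ m == 1)%R]| <= m)%N.
Proof.
move=> m0; apply: leq_trans (@card_root_XnD F m (- 1) _); last first.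
  by rewrite size_polyN size_poly1.
rewrite subset_leq_card //; apply/fintype.subsetP => x; rewrite !inE.
by rewrite hornerN hornerC subr_eq0.
Qed.

(** Binet's formula with the denominator cleared, to make sense in any commutative ring; [x - y] is
    cancelled later, where the roots are distinct. *)
Lemma lucas_binet (A : comNzRingType) (x y : A) (P Q : int) (n : nat) :
  P%:~R = x + y -> Q%:~R = x * y ->
  (lucas P Q n)%:~R * (x - y) = x ^+ n - y ^+ n.
Proof.
move=> Px Qx; elim/ltn_ind: n => -[|[|n]] IHn.
- by rewrite mul0r !expr0 subrr.
- by rewrite mul1r !expr1.
- rewrite /= -/(lucas P Q n.+1) intrB !intrM mulrBl -!mulrA !IHn // Px Qx !exprS.
  ring.
Qed.

Lemma eqz_mod_pchar (A : nzRingType) (p : nat) (a b : int) : p \in [pchar A] ->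
  (a = b %[mod p%:Z])%Z <-> a%:~R = b%:~R :> A.
Proof.
move=> chA; split=> [/eqP|/eqP e]; last apply/eqP.
  by rewrite eqz_mod_dvd (dvdz_pcharf chA) intrB subr_eq0 => /eqP.
by rewrite eqz_mod_dvd (dvdz_pcharf chA) intrB subr_eq0.
Qed.

Lemma natr_ord_inj (A : nzRingType) (p : nat) : p \in [pchar A] ->
  injective (fun i : 'I_p => (i : nat)%:R : A).
Proof.
move=> chA i j /= eij; apply/val_inj => /=.
have /(eqz_mod_pchar (i : nat)%:Z (j : nat)%:Z chA) :
    (i : nat)%:Z%:~R = (j : nat)%:Z%:~R :> A by [].
by rewrite !modz_nat !modn_small // => -[].
Qed.

Lemma frobenius_natr (A : comNzRingType) (p n : nat) : p \in [pchar A] ->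
  (n%:R : A) ^+ p = n%:R.
Proof. by move=> chA; rewrite -(pFrobenius_autE chA) pFrobenius_aut_nat. Qed.

Lemma card_frobenius_fixed (F : finFieldType) (p : nat) :
  prime p -> p \in [pchar F] -> #|[set x : F | x ^+ p == x]| = p.
Proof.
move=> p_pr chF; apply/eqP; rewrite eqn_leq; apply/andP; split.
  apply: leq_trans (@card_root_XnD F p (- 'X) _); last first.
    by rewrite size_polyN size_polyX prime_gt1.
  rewrite subset_leq_card //; apply/fintype.subsetP => x; rewrite !inE.
  by rewrite hornerN hornerX subr_eq0.
rewrite -[leqLHS]card_ord -(card_imset _ (natr_ord_inj chF)) subset_leq_card //.
by apply/fintype.subsetP => _ /imsetP[i _ ->]; rewrite inE frobenius_natr.
Qed.

Lemma frobenius_fixedP (F : finFieldType) (p : nat) (x : F) :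
  prime p -> p \in [pchar F] -> x ^+ p = x ->
  exists i : 'I_p, x = (i : nat)%:R.
Proof.
move=> p_pr chF fx; have : x \in (fun i : 'I_p => (i : nat)%:R : F) @: [set: 'I_p].
  suff -> : (fun i : 'I_p => (i : nat)%:R : F) @: [set: 'I_p] =
            [set x : F | x ^+ p == x] by rewrite inE fx.
  apply/eqP; rewrite eqEcard card_frobenius_fixed //.
  rewrite (card_imset _ (natr_ord_inj chF)) cardsT card_ord leqnn andbT.
  by apply/fintype.subsetP => _ /imsetP[i _ ->]; rewrite inE frobenius_natr.
by case/imsetP => i _ ->; exists i.
Qed.

(** By Fermat, [x ^+ n] and [y ^+ n] depend only on [n] mod p - 1, so F_n takes at most p - 1 values
    modulo [p]; choosing an index for each residue would embed [p] elements in p - 1. *)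
Lemma distinct_roots_incomplete (F : finFieldType) (p : nat) (x y : F) (P Q : int) :
  prime p -> p \in [pchar F] ->
  x != 0 -> y != 0 -> x != y -> x ^+ p = x -> y ^+ p = y ->
  P%:~R = x + y -> Q%:~R = x * y -> ~ complete_mod p P Q.
Proof.
move=> p_pr chF x0 y0 xy xp yp Px Qx cpl.
have p0 : (0 < p.-1)%N by rewrite -subn1 subn_gt0 prime_gt1.
have unit (z : F) : z != 0 -> z ^+ p = z -> z ^+ p.-1 = 1.
  move=> z0 zp; apply: (mulfI z0).
  by rewrite mulr1 -exprS prednK // prime_gt0.
have modp (z : F) n : z != 0 -> z ^+ p = z -> z ^+ n = z ^+ (n %% p.-1).
  move=> z0 zp; rewrite {1}(divn_eq n p.-1) exprD mulnC exprM unit //.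
  by rewrite expr1n mul1r.
pose g (k : 'I_p) : 'I_p.-1 := Ordinal (ltn_pmod (sval (cid (cpl k))) p0).
suff /leq_card : injective g by rewrite !card_ord -[X in (X <= _)%N](prednK (prime_gt0 p_pr)) ltnn.
move=> k l /(congr1 val) /= ekl; apply: (natr_ord_inj chF) => /=.
have /(eqz_mod_pchar _ _ chF) ek := svalP (cid (cpl k)).
have /(eqz_mod_pchar _ _ chF) el := svalP (cid (cpl l)).
rewrite -[LHS]ek -[RHS]el; apply: (@mulIf _ (x - y)); first by rewrite subr_eq0.
rewrite !(lucas_binet _ Px Qx) (modp x) // (modp y) // ekl.
by rewrite -(modp x) // -(modp y).
Qed.

(** * Elements of large order in the field with p^2 elements *)

(** When [F] has p^2 elements this means order at most p^(3/2). Letting [m] run over divisors of p^2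
    - 1 keeps the union bound short. *)
Definition small_order (F : finFieldType) (p : nat) : {set F} :=
  [set x | has (fun m => (m ^ 2 <= p ^ 3)%N && (x ^+ m == 1)) (divisors (p ^ 2).-1)].

Lemma frobenius_order2 (F : finFieldType) (p : nat) (x : F) :
  #|F| = (p ^ 2)%N -> x ^+ p ^+ p = x.
Proof. by move=> cF; rewrite -exprM mulnn -cF expf_card. Qed.

(** With L z = z^p - z, Binet turns F_n = k into L (x^n) = k L x = L (k x), which
    [large_subgroup_onto] solves in the group of powers of [x]. *)
Lemma large_order_complete (F : finFieldType) (p : nat) (x : F) (P Q : int) :
  prime p -> p \in [pchar F] -> #|F| = (p ^ 2)%N ->
  x != 0 -> x \notin small_order F p ->
  P%:~R = x + x ^+ p -> Q%:~R = x * x ^+ p -> complete_mod p P Q.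
Proof.
move=> p_pr chF cF x0; rewrite inE => /hasPn xbig Px Qx.
have Ux : x \is a GRing.unit by rewrite unitfE.
pose u := FinRing.unit F Ux.
have uX n : val (u ^+ n)%g = x ^+ n by rewrite FinRing.val_unitX.
have p20 : (0 < (p ^ 2).-1)%N.
  by rewrite -subn1 subn_gt0 -(exp1n 2) ltn_exp2r // prime_gt1.
have big : (p ^ 3 < #[u]%g ^ 2)%N.
  have := xbig #[u]%g; rewrite -dvdn_divisors // -cF -card_finField_unit.
  rewrite order_dvdG ?inE // => /(_ isT); rewrite negb_and -ltnNge => /orP[//|].
  by rewrite -uX expg_order FinRing.val_unit1 eqxx.
(* The kernel of [L] is the prime field, over which [L] is linear. *)
pose L : {additive F -> F} := pFrobenius_aut chF \- idfun.
have LE z : L z = z ^+ p - z by rewrite /L /= pFrobenius_autE.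
have kerL : #|[set t | L t == 0]| = p.
  rewrite -[RHS](card_frobenius_fixed p_pr chF); apply: eq_card => t.
  by rewrite !inE LE subr_eq0.
have linL (t z : F) : L t = 0 -> L (t * z) = t * L z.
  by rewrite !LE => /eqP; rewrite subr_eq0 exprMn mulrBr => /eqP ->.
(* An [x] in the prime field would have x^(p-1) = 1, and p - 1 is a divisor of p^2 - 1 small enough
   to put [x] in [small_order]. *)
have Lx : L x != 0.
  rewrite LE subr_eq0; apply/negP => /eqP xp.
  have xp1 : x ^+ p.-1 = 1.
    by apply: (mulfI x0); rewrite mulr1 -exprS prednK // prime_gt0.
  have := xbig p.-1; rewrite -dvdn_divisors // xp1 eqxx andbT => H.
  suff : (p.-1 ^ 2 <= p ^ 3)%N.
    by apply/negP/H; rewrite -[(p ^ 2).-1]subn1 -[X in (_ - X)%N](exp1n 2) subn_sqr subn1 dvdn_mulr.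
  apply: (@leq_trans (p ^ 2)); first by rewrite leq_exp2r // leq_pred.
  by rewrite leq_pexp2l // prime_gt0.
(* F_0 takes care of the residue 0; otherwise L (k x) is nonzero, as [large_subgroup_onto]
   requires. *)
move=> k; have [k0|k0] := eqVneq (k%:~R : F) 0.
  by exists 0%N; apply/(eqz_mod_pchar _ _ chF); rewrite k0.
have kfix : (k%:~R : F) ^+ p = k%:~R.
  by rewrite -(pFrobenius_autE chF) rmorph_int.
have Lk : L k%:~R = 0 by rewrite LE kfix subrr.
have [|||||h /cycleP[n ->] hn] := @large_subgroup_onto F L <[u]>%G (k%:~R * x).
- by [].
- by rewrite LE expr1n subrr.
- by rewrite kerL.
- by rewrite kerL.
- by rewrite linL // mulf_neq0.
exists n; apply/(eqz_mod_pchar _ _ chF); move: hn; rewrite uX linL // !LE => hn.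
apply: (@mulIf _ (x - x ^+ p)); first by move: Lx; rewrite LE -oppr_eq0 opprB.
rewrite (lucas_binet _ Px Qx) -[RHS]opprK -mulrN opprB -hn opprB.
by rewrite -!exprM mulnC.
Qed.

(** Each of the d(p^2 - 1) exponents admits at most p^(3/2) roots of unity. Tenth powers clear the
    fractional exponents: d^10 <= C^2 p^4 and M^10 <= p^15. *)
Lemma card_small_order (F : finFieldType) (p C : nat) : prime p ->
  (forall n, (0 < n)%N -> (size (divisors n) ^ 5 <= C * n)%N) ->
  (#|small_order F p| ^ 10 <= C ^ 2 * p ^ 19)%N.
Proof.
move=> p_pr divC.
have p20 : (0 < (p ^ 2).-1)%N.
  by rewrite -subn1 subn_gt0 -(exp1n 2) ltn_exp2r // prime_gt1.
set ds := divisors (p ^ 2).-1.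
pose M := (\max_(m <- ds | m ^ 2 <= p ^ 3) m)%N.
have M2 : (M ^ 2 <= p ^ 3)%N.
  rewrite /M; elim/big_ind: _ => // a b a3 b3.
  by rewrite /maxn; case: ifP.
have le : (#|small_order F p| <= size ds * M)%N.
  have -> : (size ds * M = \sum_(m <- ds) M)%N by rewrite big_const_seq count_predT iter_addn_0 mulnC.
  apply: (@leq_trans (\sum_(m <- ds | m ^ 2 <= p ^ 3) M)%N); last first.
    by rewrite [leqRHS](bigID (fun m => m ^ 2 <= p ^ 3)%N) leq_addr.
  apply: (@leq_trans (\sum_(m <- ds | m ^ 2 <= p ^ 3) \sum_(x : F) (x ^+ m == 1)%R)%N).
    rewrite exchange_big -sum1_card big_mkcond /=; apply: leq_sum => x _.
    case: ifP => //; rewrite inE => /hasP[m mds /andP[m3 xm]].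
    by rewrite (big_rem m) //= m3 xm.
  rewrite big_seq_cond [leqRHS]big_seq_cond; apply: leq_sum => m /andP[mds m3].
  rewrite -big_mkcond /= sum1dep_card.
  have m0 : (0 < m)%N by move: mds; rewrite -dvdn_divisors // => /dvdn_gt0 ->.
  by apply: leq_trans (card_unity_roots F m0) _; rewrite /M (big_rem m) //= m3 leq_maxl.
have := divC _ p20; rewrite -/ds => le5.
have {}le5 : (size ds ^ 5 <= C * p ^ 2)%N.
  by apply: leq_trans le5 _; rewrite leq_mul2l leq_pred orbT.
have le10 : (size ds ^ 10 <= C ^ 2 * p ^ 4)%N.
  by rewrite (expnM _ 5 2) (expnM p 2 2) -expnMn leq_exp2r.
have M10 : (M ^ 10 <= p ^ 15)%N.
  by rewrite (expnM _ 2 5) (expnM p 3 5) leq_exp2r.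
rewrite -(leq_exp2r _ _ (isT : 0 < 10)%N) expnMn in le.
apply: leq_trans le (leq_trans (leq_mul le10 M10) _).
by rewrite -mulnA -expnD.
Qed.

(** * Upper and lower bounds for the size of [Lambda] *)

Lemma natr_modn_pchar (A : nzRingType) (p n : nat) : p \in [pchar A] ->
  (n %% p)%N%:R = n%:R :> A.
Proof.
by move=> chA; rewrite [in RHS](divn_eq n p) natrD natrM (pcharf0 chA) mulr0 add0r.
Qed.

Lemma vieta_eq (A : idomainType) (x y z w : A) :
  z + w = x + y -> z * w = x * y -> z = x \/ z = y.
Proof.
move=> s m; have : (z - x) * (z - y) = 0.
  rewrite (_ : _ * _ = x * y - z * (x + y - z)); last by ring.
  by rewrite -s -m; ring.
by move/eqP; rewrite mulf_eq0 !subr_eq0 => /orP[]/eqP; auto.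
Qed.

(** Sum and product map the set [D] of ordered pairs of distinct nonzero residues, at most
    two-to-one, to pairs outside [Lambda]. As |D| >= p^2 - 3 p, at least (p^2 - 3 p) / 2 pairs are
    excluded. *)
Lemma card_Lambda_le (p : nat) : prime p -> (2 * #|Lambda p| <= p ^ 2 + 3 * p)%N.
Proof.
move=> p_pr; have p0 := prime_gt0 p_pr; have chF := pchar_Fp p_pr.
pose D := [set ij : 'I_p * 'I_p | [&& (0 < ij.1)%N, (0 < ij.2)%N & ij.1 != ij.2]].
pose g (ij : 'I_p * 'I_p) : 'I_p * 'I_p :=
  (Ordinal (ltn_pmod (ij.1 + ij.2)%N p0), Ordinal (ltn_pmod (ij.1 * ij.2)%N p0)).
have inj : injective (fun i : 'I_p => (i : nat)%:R : 'F_p) := natr_ord_inj chF.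
have gD : (#|D| <= 2 * #|g @: D|)%N.
  apply: (@card_le_double_imset _ _ g (fun ij => (ij.2, ij.1))).
  move=> [i j] [k l] _ _ [/= /(congr1 (fun n => n%:R : 'F_p)) + 
    /(congr1 (fun n => n%:R : 'F_p))].
  rewrite !natr_modn_pchar // !natrD !natrM => es em.
  case: (vieta_eq es em) => ek; move: (ek); rewrite -/((fun i : 'I_p => (i : nat)%:R : 'F_p) k) => /inj ->.
  - left; move: es; rewrite ek => /addrI; rewrite -/((fun i : 'I_p => (i : nat)%:R : 'F_p) l).
    by move=> /inj ->.
  - right; move: es; rewrite ek addrC => /addIr.
    by move=> /inj ->.
have dis : Lambda p \subset ~: (g @: D).
  apply/fintype.subsetP => PQ; rewrite !inE => /and3P[P0 Q0 /asboolP cpl].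
  apply/negP => /imsetP[[i j]]; rewrite inE /= => /and3P[i0 j0 ij] e.
  have nz (k : 'I_p) : (0 < k)%N -> (k : nat)%:R != 0 :> 'F_p.
    by move=> k0; rewrite -(dvdn_pcharf chF) gtnNdvd.
  have := @distinct_roots_incomplete 'F_p p i%:R j%:R PQ.1 PQ.2 p_pr chF.
  apply => //.
  - exact: nz.
  - exact: nz.
  - by apply: contra ij => /eqP/inj ->.
  - exact: frobenius_natr.
  - exact: frobenius_natr.
  - by rewrite e /= -natrD -[LHS]/(((i + j) %% p)%N%:R) natr_modn_pchar.
  - by rewrite e /= -natrM -[LHS]/(((i * j) %% p)%N%:R) natr_modn_pchar.
have cLD : (#|Lambda p| + #|g @: D| <= p ^ 2)%N.
  have := subset_leq_card dis; have := cardsC (g @: D).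
  by rewrite card_prod !card_ord mulnn => <- le; rewrite addnC leq_add2l.
(* Two axes and the diagonal, of [p] points each, cover the complement of [D]. *)
have cD : (p ^ 2 <= #|D| + 3 * p)%N.
  have -> : (p ^ 2 = #|{: 'I_p * 'I_p}|)%N by rewrite card_prod !card_ord mulnn.
  pose z := Ordinal p0.
  have cim (h : 'I_p -> 'I_p * 'I_p) : (#|h @: [set: 'I_p]| <= p)%N.
    by rewrite (leq_trans (leq_imset_card _ _)) // cardsT card_ord.
  rewrite -(cardsC D) leq_add2l.
  apply: (@leq_trans #|(pair z @: [set: 'I_p]) :|: ((pair^~ z @: [set: 'I_p])
    :|: ((fun i => (i, i)) @: [set: 'I_p]))|).
    apply/subset_leq_card/fintype.subsetP => -[i j]; rewrite !inE /= !negb_and -!eqn0Ngt negbK.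
    case/or3P => [/eqP i0|/eqP j0|/eqP <-].
    - by apply/orP; left; apply/imsetP; exists j; rewrite ?inE // (_ : i = z) //; apply/val_inj.
    - by apply/orP; right; apply/orP; left; apply/imsetP; exists i; rewrite ?inE // (_ : j = z) //; apply/val_inj.
    - by apply/orP; right; apply/orP; right; apply/imsetP; exists i; rewrite ?inE.
  rewrite (leq_trans (leq_card_setU _ _)) // mulSn leq_add //.
  by rewrite (leq_trans (leq_card_setU _ _)) // mulSn mul1n leq_add.
lia.
Qed.

(** [P] and [Q] are taken to be the trace and norm of [x], shared only by [x] and x^p. Every [x] of
    nonzero trace outside [small_order] gives a pair in [Lambda], and at most [p] elements have
    trace 0. *)
Lemma card_Lambda_ge (p : nat) (F : finFieldType) : prime p -> p \in [pchar F] ->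
  #|F| = (p ^ 2)%N -> (p ^ 2 <= 2 * #|Lambda p| + p + #|small_order F p|)%N.
Proof.
move=> p_pr chF cF; have p0 := prime_gt0 p_pr.
pose i0 := Ordinal p0.
(* [cod] inverts the embedding of residues in [F]; the default [i0] is resorted to only outside the
   prime field. *)
pose cod (x : F) : 'I_p := odflt i0 [pick i : 'I_p | (i : nat)%:R == x].
have codK (x : F) : x ^+ p = x -> (cod x : nat)%:R = x.
  move=> /(frobenius_fixedP p_pr chF)[i xi]; rewrite /cod.
  by case: pickP => [j /eqP //|/(_ i)]; rewrite xi eqxx.
pose f (x : F) := (cod (x + x ^+ p), cod (x * x ^+ p)).
have frobD (x y : F) : (x + y) ^+ p = x ^+ p + y ^+ p.
  by rewrite -!(pFrobenius_autE chF) rmorphD.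
have fix1 (x : F) : (x + x ^+ p) ^+ p = x + x ^+ p.
  by rewrite frobD (frobenius_order2 _ cF) addrC.
have fix2 (x : F) : (x * x ^+ p) ^+ p = x * x ^+ p.
  by rewrite exprMn (frobenius_order2 _ cF) mulrC.
(* Membership in [Z] means that the trace P is 0, which [Lambda] excludes. *)
pose Z := [set x : F | x ^+ p + 'X.[x] == 0].
have cZ : (#|Z| <= p)%N by apply: card_root_XnD; rewrite size_polyX prime_gt1.
pose G := ~: (Z :|: small_order F p).
have cG : (p ^ 2 <= #|G| + p + #|small_order F p|)%N.
  rewrite -cF -(cardsC G) finset.setCK -addnA leq_add2l.
  by apply: leq_trans (leq_card_setU _ _) _; rewrite leq_add2r.
apply: leq_trans cG _; rewrite !leq_add2r.
apply: (@leq_trans (2 * #|f @: G|)).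
  apply: (@card_le_double_imset _ _ f (fun x => x ^+ p)) => x y _ _ [e1 e2].
  apply: vieta_eq (y ^+ p) _ _.
  - by rewrite -(codK _ (fix1 x)) -(codK _ (fix1 y)) e1.
  - by rewrite -(codK _ (fix2 x)) -(codK _ (fix2 y)) e2.
rewrite leq_mul2l /= subset_leq_card //; apply/fintype.subsetP => _ /imsetP[x + ->].
rewrite !inE negb_or hornerX => /andP[tr big].
have x0 : x != 0.
  by apply: contra tr => /eqP ->; rewrite expr0n gtn_eqF // addr0.
have pos k : (cod k : nat)%:R != 0 :> F -> (0 < cod k)%N.
  by rewrite lt0n; apply: contra => /eqP ->.
apply/and3P; split; rewrite /=.
- by apply: pos; rewrite codK // addrC.
- by apply: pos; rewrite codK // mulf_neq0 // expf_neq0.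
apply/asboolP/(large_order_complete p_pr chF cF x0); first by rewrite inE.
- exact: codK.
- exact: codK.
Qed.

(** * Passage to the limit along the primes *)

Local Open Scope classical_set_scope.

(** The limsup is the infimum, over members of [F], of the supremum of [u]. The member where |u - l|
    <= e bounds it by l + e; properness makes every member meet that one, whence the lower bound l -
    e. *)
Lemma limf_esup_eq (R : realType) (F : set_system nat) (u : nat -> R) (l : R) :
  ProperFilter F ->
  (forall e, 0 < e -> \forall n \near F, `|u n - l| <= e) ->
  limf_esup (fun n => (u n)%:E) F = l%:E.
Proof.
move=> PF ul; apply/eqP; rewrite limf_esupE eq_le; apply/andP; split.
  apply/lee_addgt0Pr => e e0; pose V := [set n | `|u n - l| <= e].
  apply: (@le_trans _ _ (ereal_sup [set (u n)%:E | n in V])).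
    by apply: ereal_inf_lbound; exists V => //; exact: ul.
  apply: ge_ereal_sup => _ [n Vn <-]; rewrite lee_fin.
  by move: Vn; rewrite /V /= ler_norml; lra.
apply: le_ereal_inf_tmp => _ [V FV <-].
apply/lee_addgt0Pr => e e0.
have [n [Vn]] := filter_ex (filterI FV (ul e e0)).
rewrite /= ler_norml => un.
apply: (@le_trans _ _ ((u n)%:E + e%:E)%E); first by rewrite lee_fin; lra.
by rewrite leeD2r //; apply: ereal_sup_ubound; exists n.
Qed.

(** Properness comes from the infinitude of primes. *)
Lemma within_prime_proper : ProperFilter (within [set p : nat | prime p] \oo).
Proof.
apply: Build_ProperFilter_ex => A; rewrite /within /= => -[N _ NA].
by have [p Np pp] := prime_above N; exists p; apply: NA => //=; exact: ltnW.
Qed.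

Theorem theorem4 (R : realType) :
  limf_esup (fun p : nat => (#|Lambda p|%:R / p%:R ^+ 2 : R)%:E)
    (within [set p : nat | prime p] \oo) = (1 / 2 : R)%:E.
Proof.
apply: limf_esup_eq; first exact: within_prime_proper.
have [C divC] := size_divisors_pow5.
move=> e e0; rewrite near_withinE.
near=> p.
(* The first threshold absorbs the error terms linear in [p]; the second turns s^10 <= C^2 p^19 into
   s <= e p^2, where [s] is the size of [small_order]. *)
have p_ge1 : 2 / e <= p%:R by near: p; exact: nbhs_infty_ger.
have p_ge2 : C%:R ^+ 2 / e ^+ 10 <= p%:R by near: p; exact: nbhs_infty_ger.
move=> /= p_pr.
have [F chF cF] := pPrimePowerField p_pr (isT : 0 < 2)%N.
have := card_Lambda_le p_pr; have := card_Lambda_ge p_pr chF cF.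
have := card_small_order F p_pr divC.
move: #|small_order F p| #|Lambda p| => s n.
move=> s10n lon upn.
have s10 : s%:R ^+ 10 <= C%:R ^+ 2 * p%:R ^+ 19 :> R by rewrite -!natrX -natrM ler_nat.
have lo : p%:R ^+ 2 <= 2 * n%:R + p%:R + s%:R :> R.
  by rewrite -natrX -natrM -!natrD ler_nat.
have up : 2 * n%:R <= p%:R ^+ 2 + 3 * p%:R :> R.
  by rewrite -natrX -!natrM -natrD ler_nat.
move: p_ge1 p_ge2; set x : R := p%:R in s10 lo up * => p_ge1 p_ge2.
have x0 : 0 < x by rewrite ltr0n prime_gt0.
have ex : 2 <= e * x.
  by rewrite mulrC -ler_pdivrMr //.
have eC : C%:R ^+ 2 <= e ^+ 10 * x.
  by rewrite mulrC -ler_pdivrMr ?exprn_gt0 //.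
have sx : s%:R <= e * x ^+ 2.
  rewrite -(@ler_pXn2r _ 10) ?nnegrE ?mulr_ge0 ?exprn_ge0 ?(ltW e0) ?(ltW x0) //.
  apply: le_trans s10 _; rewrite exprMn -exprM.
  rewrite (_ : e ^+ 10 * _ = e ^+ 10 * x * x ^+ 19); last by rewrite -mulrA -exprS.
  by rewrite ler_wpM2r // exprn_ge0 // ltW.
have x2 : 0 < x ^+ 2 by rewrite exprn_gt0.
have xe : 2 * x <= e * x ^+ 2 by rewrite expr2 mulrA ler_wpM2r // ltW.
(* Multiplied by p^2, the goal is |n - p^2 / 2| <= e p^2, a linear consequence of [lo], [up], [sx]
   and [xe]. *)
rewrite -(ler_pM2r x2) -[X in _ * X]gtr0_norm // -normrM mulrBl mulfVK ?gt_eqF //.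
by rewrite ler_norml; lra.
Unshelve. all: end_near.
Qed.
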